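(* Assume: (i) for all $m\in\{1,\dots,d\}$ and all $u,v\in\mathcal{V}$, $$\Big\langle u,\frac{\partial v}{\partial\hat x_m}\Big\rangle_{\mathbf W}+\Big\langle\frac{\partial u}{\partial\hat x_m},v\Big\rangle_{\mathbf W}=\sum_{\gamma=1}^{N_f}\hat n^{(\gamma)}_m\langle u,v\rangle_{\mathbf W^{(\gamma)}};$$ (ii) $\mathbf V$ has rank $N_p$, and $\mathbf W$ and all $\mathbf W^{(\gamma)}$, $\gamma\in\{1,\dots,N_f\}$, are symmetric positive definite; (iii) $\mathbf M^{(\kappa)}$ is invertible for all $\kappa\in\{1,\dots,K\}$; (iv) $\mathbf K\mathbf D^{(m)}=\mathbf 0$ for all $m\in\{1,\dots,d\}$ and $\mathbf M+\mathbf K$ is symmetric positive definite. Let $\mathbf L^{(\gamma)}:=(\mathbf M+\mathbf K)^{-1}(\mathbf V^{(\gamma)})^T\mathbf W^{(\gamma)}$, $\mathbf F:=(\mathbf I+\mathbf M^{-1}\mathbf K)^{-1}$ and $\mathbf F^{(\kappa)}:=(\mathbf P\mathbf J^{(\kappa)}\mathbf V)^{-1}\mathbf F(\mathbf P\mathbf J^{(\kappa)}\mathbf V)$. Then the flux reconstruction (FR) method $$\mathbf P\mathbf J^{(\kappa)}\mathbf V\frac{d u^{(h,\kappa,e)}}{dt}+\sum_{m=1}^d\mathbf D^{(m)}\mathbf P f^{(h,\kappa,m,e)}+\sum_{\gamma=1}^{N_f}\mathbf L^{(\gamma)}\Big(f^{( *,\kappa,\gamma,e)}-\sum_{n=1}^d\hat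 n^{(\gamma)}_n\mathbf V^{(\gamma)}\mathbf P f^{(h,\kappa,n,e)}\Big)=0$$ (for all $\kappa\in\{1,\dots,K\}$, $e\in\{1,\dots,N_{\rm Eq}\}$, $t\in(0,T)$) is equivalent to the filtered weak-form discontinuous Galerkin (DG) method $$\mathbf M^{(\kappa)}(\mathbf F^{(\kappa)})^{-1}\frac{d u^{(h,\kappa,e)}}{dt}-\sum_{m=1}^d(\mathbf D^{(m)})^T\mathbf V^T\mathbf W f^{(h,\kappa,m,e)}+\sum_{\gamma=1}^{N_f}(\mathbf V^{(\gamma)})^T\mathbf W^{(\gamma)}f^{( *,\kappa,\gamma,e)}=0$$ (for all $\kappa,e,t$), i.e. a family of coefficient vectors $u^{(h,\kappa,e)}(t)$ satisfies one system if and only if it satisfies the other.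
   Context: Reference element and operators. $\hat\Omega\subset\mathbb{R}^d$ is a polytope with volume $|\hat\Omega|$, flat facets $\hat\Gamma^{(\gamma)}$, $\gamma\in\{1,\dots,N_f\}$, and outward unit normals $\hat n^{(\gamma)}$. $\mathcal{V}$ is the space of real polynomial functions on $\hat\Omega$ spanned by the monomials with exponents in a finite set $\mathcal{N}\supseteq\{\alpha\in\mathbb{N}_0^d:|\alpha|\le p\}$ of $N_p$ multi-indices ($p\in\mathbb{N}_0$); $\mathcal{V}$ is assumed closed under each $\partial/\partial\hat x_m$ and contains the constants. $\{\phi^{(i)}\}_{i=1}^{N_p}$ is an arbitrary basis of $\mathcal{V}$. Volume nodes $\hat x^{(i)}\in\hat\Omega$, $i\in\{1,\dots,N\}$ ($N\ge N_p$), facet nodes $\hat x^{(\gamma,i)}\in\hat\Gamma^{(\gamma)}$, $i\in\{1,\dots,N_\gamma\}$, and matrices $\mathbf W\in\mathbb{R}^{N\times N}$, $\mathbf W^{(\gamma)}\in\mathbb{R}^{N_\gamma\times N_\gamma}$ are given; $\langle u,v\rangle_{\mathbf W}:=\sum_{i,j}u(\hat x^{(i)})W_{ij}v(\hat x^{(j)})$ and $\langle u,v\rangle_{\mathbf W^{(\gamma)}}:=\sum_{i,j}u(\hat x^{(\gamma,i)})W^{(\gamma)}_{ij}v(\hat x^{(\gamma,j)})$. Set $V_{ij}:=\phi^{(j)}(\hat x^{(i)})$, $V^{(\gamma)}_{ij}:=\phi^{(j)}(\hat x^{(\gamma,i)})$, $\mathbf M:=\mathbf V^T\mathbf W\mathbf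 V$, $\mathbf P:=\mathbf M^{-1}\mathbf V^T\mathbf W$, and define $\mathbf D^{(m)}$ by $\partial\phi^{(j)}/\partial\hat x_m=\sum_iD^{(m)}_{ij}\phi^{(i)}$. For a finite set $\mathcal{M}\subset\mathcal{N}$ and $C:\mathcal{M}\to\mathbb{R}$, $\mathbf K:=\sum_{\alpha\in\mathcal{M}}\frac{C(\alpha)}{|\hat\Omega|}(\mathbf D^{(\alpha)})^T\mathbf M\mathbf D^{(\alpha)}$ with $\mathbf D^{(\alpha)}:=(\mathbf D^{(1)})^{\alpha_1}\cdots(\mathbf D^{(d)})^{\alpha_d}$. Mesh. $\bar\Omega\subset\mathbb{R}^d$ is the union of compact elements $\Omega^{(\kappa)}$, $\kappa\in\{1,\dots,K\}$, with disjoint interiors, each the image of $\hat\Omega$ under a smooth bijective time-independent map $X^{(\kappa)}$ with Jacobian matrix $\boldsymbol{\mathcal J}^{(\kappa)}$ and $\mathcal J^{(\kappa)}:=\det\boldsymbol{\mathcal J}^{(\kappa)}>0$; $\Gamma^{(\kappa,\gamma)}:=X^{(\kappa)}(\hat\Gamma^{(\gamma)})$ has outward unit normal $n^{(\kappa,\gamma)}$, and $\mathcal J^{(\kappa,\gamma)}(\hat x):=\|\mathcal J^{(\kappa)}(\hat x)(\boldsymbol{\mathcal J}^{(\kappa)}(\hat x))^{-T}\hat n^{(\gamma)}\|_2$. $\mathbf J^{(\kappa)}:=\mathrm{diag}(\mathcal J^{(\kappa)}(\hat x^{(1)}),\dots,\mathcal J^{(\kappa)}(\hat x^{(N)}))$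 and $\mathbf M^{(\kappa)}:=\mathbf V^T\mathbf W\mathbf J^{(\kappa)}\mathbf V$. Semi-discrete quantities. The conservation law is $\partial_tU+\sum_{m=1}^d\partial_{x_m}F^{(m)}(U)=0$ with $U\in\Upsilon\subseteq\mathbb{R}^{N_{\rm Eq}}$ and $F^{(m)}:\Upsilon\to\mathbb{R}^{N_{\rm Eq}}$. Unknown (differentiable in $t$) vectors $u^{(h,\kappa,e)}(t)\in\mathbb{R}^{N_p}$ define $U^{(h,\kappa)}_e(\hat x,t)=\sum_iu^{(h,\kappa,e)}_i(t)\phi^{(i)}(\hat x)$, assumed to take values in $\Upsilon$. The vector $f^{(h,\kappa,m,e)}(t)\in\mathbb{R}^N$ has entries equal to the $e$-th component of $\sum_{n=1}^d\mathcal J^{(\kappa)}[(\boldsymbol{\mathcal J}^{(\kappa)})^{-1}]_{mn}F^{(n)}(U^{(h,\kappa)})$ at the nodes $\hat x^{(i)}$; the vector $f^{( *,\kappa,\gamma,e)}(t)\in\mathbb{R}^{N_\gamma}$ has entries equal to the $e$-th component of $\mathcal J^{(\kappa,\gamma)}F^*(U^{(h,\kappa)},U^{(+,\kappa,\gamma)},n^{(\kappa,\gamma)}\circ X^{(\kappa)})$ at the nodes $\hat x^{(\gamma,i)}$, where $F^*:\Upsilon\times\Upsilon\times\mathbb{S}^{d-1}\to\mathbb{R}^{N_{\rm Eq}}$ is a consistent and conservative numerical flux and $U^{(+,\kappa,\gamma)}$ is external (neighbour or boundary) data. *)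

(* Defs.v *)
From HB Require Import structures.
From mathcomp Require Import all_boot all_order all_algebra finmap.
From mathcomp Require Import all_classical all_reals all_analysis.

Set Implicit Arguments.
Unset Strict Implicit.
Unset Printing Implicit Defensive.

Import Order.TTheory GRing.Theory Num.Theory.
Import numFieldNormedType.Exports.

Local Open Scope classical_set_scope.
Local Open Scope ring_scope.

(* Points of R^d and coefficient/nodal vectors are column vectors.  The library
   norm on matrices is the sup norm, hence the separate Euclidean norm below;
   both induce the same topology. *)

Section Euclidean.
Variable R : realType.

Definition dot n (x y : 'cV[R]_n) : R := \sum_(i < n) x i 0 * y i 0.

Definition norm2 n (x : 'cV[R]_n) : R := Num.sqrt (dot x x).

Definition spd n (A : 'M[R]_n) : Prop :=
  A^T = A /\ forall x : 'cV[R]_n, x != 0 -> 0 < (x^T *m A *m x) 0 0.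

(* Iterated Lebesgue integral of the indicator function; by Tonelli this is the
   d-dimensional Lebesgue measure on Borel sets, in particular on polytopes. *)
Fixpoint volume (d : nat) : set 'cV[R]_d -> \bar R :=
  match d return set 'cV[R]_d -> \bar R with
  | 0 => fun A => (\1_A 0)%:E
  | d'.+1 => fun A => (\int[lebesgue_measure]_x
      volume [set y : 'cV[R]_d' | A (col_mx (const_mx x : 'cV[R]_1) y)])%E
  end.

Definition hyperplane d (n : 'cV[R]_d) (c : R) : set 'cV[R]_d :=
  [set x | dot n x = c].

Definition conv d (s : seq 'cV[R]_d) : set 'cV[R]_d :=
  [set x | exists w : 'I_(size s) -> R,
    [/\ forall i, 0 <= w i, \sum_i w i = 1 & x = \sum_i w i *: s`_i]].

Definition relint d (H A : set 'cV[R]_d) : set 'cV[R]_d :=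
  [set x | A x /\ \forall y \near x, H y -> A y].

(* A is a (not necessarily convex) polytope of full dimension in the affine
   subspace H: a finite nonempty union of convex hulls of finite subsets of H,
   each with nonempty interior relative to H. *)
Definition polytope_in d (H A : set 'cV[R]_d) : Prop :=
  exists cells : seq (seq 'cV[R]_d),
    [/\ cells != [::], A = \bigcup_(s in [set` cells]) conv s &
      forall s, s \in cells -> conv s `<=` H /\ relint H (conv s) !=set0].

End Euclidean.

Section Differentiation.
Variables (R : realType) (d : nat).

Definition pderiv (m : 'I_d) (f : 'cV[R]_d -> R) : 'cV[R]_d -> R :=
  fun x => 'D_(delta_mx m 0) f x.

Definition smooth_near (A : set 'cV[R]_d) (f : 'cV[R]_d -> R) : Prop :=
  exists2 U : set 'cV[R]_d, open U /\ A `<=` U &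
    forall (s : seq 'I_d) x, U x -> differentiable (foldr pderiv f s) x.

(* J m n is the n-th partial derivative of the m-th component; the library's
   [jacobian] is the transposed matrix and only for row vectors. *)
Definition jac (X : 'cV[R]_d -> 'cV[R]_d) (x : 'cV[R]_d) : 'M[R]_d :=
  \matrix_(m, n) pderiv n (fun y => X y m 0) x.

End Differentiation.

Notation multiindex d := {ffun 'I_d -> nat}.

Section Polynomials.
Variables (R : realType) (d : nat).

Definition monomial (a : multiindex d) (x : 'cV[R]_d) : R :=
  \prod_(m < d) x m 0 ^+ a m.

(* Polynomial functions are taken on all of R^d: a polynomial is determined by
   its restriction to a set with nonempty interior. *)
Definition polyspace (A : {fset (multiindex d)}) : set ('cV[R]_d -> R) :=
  [set u | exists c : multiindex d -> R,
    u = fun x => \sum_(a <- A) c a * monomial a x].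

Definition is_basis n (V : set ('cV[R]_d -> R)) (phi : 'I_n -> 'cV[R]_d -> R)
    : Prop :=
  [/\ forall j, V (phi j),
      forall c : 'I_n -> R,
        (forall x, \sum_j c j * phi j x = 0) -> forall j, c j = 0 &
      forall u, V u -> exists c : 'I_n -> R,
        u = fun x => \sum_j c j * phi j x].

End Polynomials.

Record refElement (R : realType) (d : nat) := RefElement {
  rdom : set 'cV[R]_d;
  nfac : nat;
  facet : 'I_nfac -> set 'cV[R]_d;
  rnormal : 'I_nfac -> 'cV[R]_d;
  offset : 'I_nfac -> R;
  rdom_polytope : polytope_in setT rdom;
  rdom_connected : connected rdom;
  rdom_boundary : rdom `\` rdom° = \bigcup_g facet g;
  facet_flat : forall g,
    polytope_in (hyperplane (rnormal g) (offset g)) (facet g);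
  facet_disjoint : forall g g', g != g' ->
    relint (hyperplane (rnormal g) (offset g)) (facet g) `&`
    relint (hyperplane (rnormal g') (offset g')) (facet g') = set0;
  rnormal_unit : forall g, norm2 (rnormal g) = 1;
  rnormal_outward : forall g x,
    relint (hyperplane (rnormal g) (offset g)) (facet g) x ->
    \forall s \near 0^'+,
      rdom° (x - s *: rnormal g) /\ ~ rdom (x + s *: rnormal g)
}.

Record refDiscretization (R : realType) (d : nat) (E : refElement R d) :=
  RefDiscretization {
  deg : nat;
  exps : {fset (multiindex d)};
  exps_deg : forall a : multiindex d,
    (\sum_(m < d) a m <= deg)%N -> a \in exps;
  polyspace_cst : forall c : R, polyspace exps (cst c);
  polyspace_pderiv : forall m (u : 'cV[R]_d -> R),
    polyspace exps u -> polyspace exps (pderiv m u);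
  phi : 'I_(#|` exps|) -> 'cV[R]_d -> R;
  phi_basis : is_basis (polyspace exps) phi;
  nvol : nat;
  nvol_ge : (#|` exps| <= nvol)%N;
  vnode : 'I_nvol -> 'cV[R]_d;
  vnode_in : forall i, rdom E (vnode i);
  nfn : 'I_(nfac E) -> nat;
  fnode : forall g : 'I_(nfac E), 'I_(nfn g) -> 'cV[R]_d;
  fnode_in : forall (g : 'I_(nfac E)) (i : 'I_(nfn g)),
    facet g (fnode i);
  Wmx : 'M[R]_nvol;
  Wfmx : forall g : 'I_(nfac E), 'M[R]_(nfn g);
  (* matrix of the m-th partial derivative in the basis phi, which
     determines it uniquely *)
  Dmx : 'I_d -> 'M[R]_(#|` exps|);
  DmxE : forall m j,
    pderiv m (phi j) = fun x => \sum_i Dmx m i j * phi i x;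
  kexps : {fset (multiindex d)};
  kexps_sub : (kexps `<=` exps)%fset;
  kcoef : multiindex d -> R  (* only its values on [kexps] are used *)
}.

Section ReferenceOperators.
Variables (R : realType) (d : nat) (E : refElement R d).
Variable S : refDiscretization E.

Definition Np : nat := #|` exps S|.

Definition polyV : set ('cV[R]_d -> R) := polyspace (exps S).

Definition ipW (u v : 'cV[R]_d -> R) : R :=
  \sum_(i < nvol S) \sum_(j < nvol S) u (vnode i) * Wmx S i j * v (vnode j).

Definition ipWf (g : 'I_(nfac E)) (u v : 'cV[R]_d -> R) : R :=
  \sum_(i < nfn S g) \sum_(j < nfn S g)
    u (fnode i) * Wfmx S g i j * v (fnode j).

Definition Vmx : 'M[R]_(nvol S, Np) := \matrix_(i, j) phi j (vnode i).

Definition Vfmx (g : 'I_(nfac E)) : 'M[R]_(nfn S g, Np) :=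
  \matrix_(i, j) phi j (fnode i).

Definition Mmx : 'M[R]_Np := Vmx^T *m Wmx S *m Vmx.

Definition Pmx : 'M[R]_(Np, nvol S) := invmx Mmx *m Vmx^T *m Wmx S.

Definition Dpow (a : multiindex d) : 'M[R]_Np :=
  \prod_(m < d) (Dmx S m : 'M[R]_Np) ^+ a m.

Definition Kmx : 'M[R]_Np :=
  \sum_(a <- kexps S) (kcoef S a / fine (volume (rdom E))) *:
    ((Dpow a)^T *m Mmx *m Dpow a).

Definition Lmx (g : 'I_(nfac E)) : 'M[R]_(Np, nfn S g) :=
  invmx (Mmx + Kmx) *m (Vfmx g)^T *m Wfmx S g.

Definition Fmx : 'M[R]_Np := invmx (1%:M + invmx Mmx *m Kmx).

End ReferenceOperators.

(* The normal to X(facet) at X(x): orthogonal to the images of the directions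
   tangent to the facet, and on the same side as the image of the outward
   direction of the reference facet. *)
Definition outward_unit_normal (R : realType) (d : nat)
    (X : 'cV[R]_d -> 'cV[R]_d) (nhat x n : 'cV[R]_d) : Prop :=
  [/\ norm2 n = 1,
      forall v, dot nhat v = 0 -> dot n (jac X x *m v) = 0 &
      0 < dot n (jac X x *m nhat)].

Record mesh (R : realType) (d : nat) (E : refElement R d) := Mesh {
  pdom : set 'cV[R]_d;
  nelt : nat;
  Xmap : 'I_nelt -> 'cV[R]_d -> 'cV[R]_d;
  Xmap_smooth : forall k m, smooth_near (rdom E) (fun x => Xmap k x m 0);
  Xmap_inj : forall k, {in rdom E &, injective (Xmap k)};
  Xmap_det : forall k x, rdom E x -> 0 < \det (jac (Xmap k) x);
  elt_compact : forall k, compact (Xmap k @` rdom E);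
  elt_disjoint : forall k k', k != k' ->
    (Xmap k @` rdom E)° `&` (Xmap k' @` rdom E)° = set0;
  elt_cover : closure pdom = \bigcup_k (Xmap k @` rdom E);
  pnormal : 'I_nelt -> 'I_(nfac E) -> 'cV[R]_d -> 'cV[R]_d;
  pnormalP : forall k g x, facet g x ->
    outward_unit_normal (Xmap k) (rnormal g) x (pnormal k g (Xmap k x))
}.

(* The fluxes are total functions; only their values for states in [Ups] and
   unit normals matter. *)
Record conservationLaw (R : realType) (d Neq : nat) := ConservationLaw {
  Ups : set 'cV[R]_Neq;
  flux : 'I_d -> 'cV[R]_Neq -> 'cV[R]_Neq;
  numflux : 'cV[R]_Neq -> 'cV[R]_Neq -> 'cV[R]_d -> 'cV[R]_Neq;
  numflux_consistent : forall U n, Ups U -> norm2 n = 1 ->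
    numflux U U n = \sum_m n m 0 *: flux m U;
  numflux_conservative : forall U U' n, Ups U -> Ups U' -> norm2 n = 1 ->
    numflux U U' n = - numflux U' U (- n)
}.

Section SemiDiscrete.
Variables (R : realType) (d Neq : nat) (E : refElement R d).
Variables (S : refDiscretization E) (Me : mesh E).
Variable Law : conservationLaw R d Neq.

Definition detJ (k : 'I_(nelt Me)) (x : 'cV[R]_d) : R := \det (jac (Xmap k) x).

Definition Jfac (k : 'I_(nelt Me)) (g : 'I_(nfac E)) (x : 'cV[R]_d) : R :=
  norm2 (detJ k x *: (invmx (jac (Xmap k) x))^T *m rnormal g).

Definition Jmx (k : 'I_(nelt Me)) : 'M[R]_(nvol S) :=
  diag_mx (\row_i detJ k (vnode i)).

Definition Mkmx (k : 'I_(nelt Me)) : 'M[R]_(Np S) :=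
  (Vmx S)^T *m Wmx S *m Jmx k *m Vmx S.

Definition PJV (k : 'I_(nelt Me)) : 'M[R]_(Np S) := Pmx S *m Jmx k *m Vmx S.

Definition Fkmx (k : 'I_(nelt Me)) : 'M[R]_(Np S) :=
  invmx (PJV k) *m Fmx S *m PJV k.

Definition coeffs : Type := 'I_(nelt Me) -> 'I_Neq -> R -> 'cV[R]_(Np S).

Definition Uh (u : coeffs) (k : 'I_(nelt Me)) (t : R) (x : 'cV[R]_d)
    : 'cV[R]_Neq :=
  \col_e \sum_(i < Np S) u k e t i 0 * phi i x.

(* External states at (k, g, t, x), x on the reference facet g.  They may depend
   on the numerical solution (neighbour traces, boundary conditions). *)
Definition extData : Type :=
  coeffs -> 'I_(nelt Me) -> 'I_(nfac E) -> R -> 'cV[R]_d -> 'cV[R]_Neq.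

Definition admissible (T : R) (Uplus : extData) (u : coeffs) : Prop :=
  [/\ forall k e t, 0 < t < T -> derivable (u k e) t 1,
      forall k t x, 0 < t < T -> rdom E x -> Ups Law (Uh u k t x) &
      forall k g t x, 0 < t < T -> facet g x -> Ups Law (Uplus u k g t x)].

Definition fvec (u : coeffs) (k : 'I_(nelt Me)) (m : 'I_d) (e : 'I_Neq) (t : R)
    : 'cV[R]_(nvol S) :=
  \col_i (\sum_(n < d)
    (detJ k (vnode i) * invmx (jac (Xmap k) (vnode i)) m n) *:
      flux Law n (Uh u k t (vnode i))) e 0.

Definition fstar (Uplus : extData) (u : coeffs) (k : 'I_(nelt Me))
    (g : 'I_(nfac E)) (e : 'I_Neq) (t : R) : 'cV[R]_(nfn S g) :=
  \col_i (Jfac k g (fnode i) *: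
    numflux Law (Uh u k t (fnode i)) (Uplus u k g t (fnode i))
      (pnormal k g (Xmap k (fnode i)))) e 0.

Definition FR_method (T : R) (Uplus : extData) (u : coeffs) : Prop :=
  forall k e t, 0 < t < T ->
    PJV k *m derive1 (u k e) t
    + \sum_(m < d) Dmx S m *m Pmx S *m fvec u k m e t
    + \sum_(g < nfac E) Lmx S g *m
        (fstar Uplus u k g e t
         - \sum_(n < d) rnormal g n 0 *: (Vfmx S g *m Pmx S *m fvec u k n e t))
    = 0.

Definition filteredDG_method (T : R) (Uplus : extData) (u : coeffs) : Prop :=
  forall k e t, 0 < t < T ->
    Mkmx k *m invmx (Fkmx k) *m derive1 (u k e) t
    - \sum_(m < d) (Dmx S m)^T *m (Vmx S)^T *m Wmx S *m fvec u k m e t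
    + \sum_(g < nfac E) (Vfmx S g)^T *m Wfmx S g *m fstar Uplus u k g e t
    = 0.

End SemiDiscrete.

(* Main.v *)
Require Import Defs.
From HB Require Import structures.
From mathcomp Require Import all_boot all_order all_algebra finmap.
From mathcomp Require Import all_classical all_reals all_analysis.

Set Implicit Arguments.
Unset Strict Implicit.
Unset Printing Implicit Defensive.

Import Order.TTheory GRing.Theory Num.Theory.
Import numFieldNormedType.Exports.

Local Open Scope classical_set_scope.
Local Open Scope ring_scope.

(** The two methods differ by left multiplication by the matrix M + K, which is
    invertible; so each residual vanishes exactly when the other one does.

    For the time derivative, the discrete mass matrix factors as
    M^(k) = M (P J V), and the filter F satisfies M F^-1 = M + K.  Conjugation
    by P J V makes these fit together: M^(k) (F^(k))^-1 = (M + K) (P J V)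
    ([Mkmx_invFkmx]).

    For the numerical fluxes, M + K cancels the inverse in the lifting matrix L,
    leaving V_g^T W_g.

    For the volume fluxes, K D = 0 gives (M + K) D P f = M D P f, and the facet
    correction subtracts sum_g n_g V_g^T W_g V_g P f.  The summation-by-parts
    property, read on the basis functions, is the matrix identity
    M D + D^T M = sum_g n_g V_g^T W_g V_g ([sbp_matrix]).  What remains is
    - D^T M P f, and M P = V^T W turns this into the weak-form term
    - D^T V^T W f.

    All this needs M to be invertible, which holds because M is the Gram matrix
    of the columns of V, linearly independent by the rank hypothesis, for the
    positive definite matrix W. *)

Section PositiveDefinite.
Variable R : realType.

(** A vector in the kernel of a singular matrix would be a nonzero zero of the
    quadratic form. *)
Lemma spd_unitmx n (A : 'M[R]_n) : spd A -> A \in unitmx.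
Proof.
move=> [_ Apos]; rewrite -unitmx_tr unitmxE unitfE; apply/det0P => -[v v0 vA0].
have Av0 : A *m v^T = 0 by rewrite -[A]trmxK -trmx_mul vA0 trmx0.
have vT0 : v^T != 0 by rewrite -[0]trmx0 (inj_eq trmx_inj).
by have := Apos _ vT0; rewrite -mulmxA Av0 mulmx0 mxE ltxx.
Qed.

Lemma spd_congr n p (W : 'M[R]_n) (V : 'M[R]_(n, p)) :
  \rank V = p -> spd W -> spd (V^T *m W *m V).
Proof.
move=> rV [Wsym Wpos]; split.
  by rewrite !trmx_mul trmxK Wsym mulmxA.
move=> x x0; have Vx0 : V *m x != 0.
  apply: contraNneq x0 => Vx0; rewrite -[x]trmxK -[eqbRHS]trmx0.
  have VTfree : row_free V^T by rewrite /row_free mxrank_tr rV.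
  apply/eqP; congr trmx; apply: (row_free_inj VTfree).
  by rewrite -trmx_mul Vx0 trmx0 mul0mx.
by have := Wpos _ Vx0; rewrite trmx_mul !mulmxA.
Qed.

End PositiveDefinite.

Lemma mulmx3E (R : comPzRingType) n p q r (A : 'M[R]_(n, p)) (W : 'M[R]_(n, q))
    (B : 'M[R]_(q, r)) i j :
  (A^T *m W *m B) i j = \sum_k \sum_l A k i * W k l * B l j.
Proof.
rewrite mxE exchange_big /=; apply: eq_bigr => l _.
by rewrite mxE big_distrl; apply: eq_bigr => k _; rewrite mxE.
Qed.

Section ReferenceOperators.
Variables (R : realType) (d : nat) (E : refElement R d).
Variable S : refDiscretization E.

Lemma Vmx_Dmx m i j :
  (Vmx S *m Dmx S m) i j = pderiv m (phi j) (vnode i).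
Proof.
rewrite mxE (@DmxE _ _ _ S).
by apply: eq_bigr => l _; rewrite mxE mulrC.
Qed.

(** Both sides are Gram matrices on the basis: V D holds the nodal values of the
    differentiated basis, so each entry is the hypothesis for one pair of basis
    functions. *)
Lemma sbp_matrix m :
  (forall u v : 'cV[R]_d -> R, polyV S u -> polyV S v ->
     ipW S u (pderiv m v) + ipW S (pderiv m u) v
     = \sum_(g < nfac E) rnormal g m 0 * ipWf S g u v) ->
  Mmx S *m Dmx S m + (Dmx S m)^T *m Mmx S
  = \sum_(g < nfac E) rnormal g m 0 *: ((Vfmx S g)^T *m Wfmx S g *m Vfmx S g).
Proof.
move=> sbp; apply/matrixP => i j; have [phiV _ _] := phi_basis S.
rewrite summxE.
transitivity (ipW S (phi i) (pderiv m (phi j)) + ipW S (pderiv m (phi i)) (phi j)).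
  rewrite mxE /Mmx -!mulmxA; congr (_ + _).
    rewrite !mulmxA -mulmxA mulmx3E.
    by apply: eq_bigr => k _; apply: eq_bigr => l _; rewrite Vmx_Dmx mxE.
  rewrite !mulmxA -trmx_mul mulmx3E.
  by apply: eq_bigr => k _; apply: eq_bigr => l _; rewrite Vmx_Dmx !mxE.
rewrite (sbp _ _ (phiV i) (phiV j)).
apply: eq_bigr => g _; rewrite mxE mulmx3E; congr (_ * _).
by apply: eq_bigr => k _; apply: eq_bigr => l _; rewrite !mxE.
Qed.

Hypothesis M_unit : Mmx S \in unitmx.

Lemma Mmx_Pmx : Mmx S *m Pmx S = (Vmx S)^T *m Wmx S.
Proof. by rewrite /Pmx !mulmxA mulmxV // mul1mx. Qed.

Variable Me : mesh E.

Lemma Mmx_PJV (k : 'I_(nelt Me)) : Mmx S *m PJV S k = Mkmx S k.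
Proof. by rewrite /PJV -mulmxA mulmxA Mmx_Pmx mulmxA. Qed.

(** Writing M^(k) = M (P J V), the left conjugating factor of (F^(k))^-1
    cancels, which leaves M F^-1 (P J V), and M F^-1 = M (1 + M^-1 K) = M + K. *)
Lemma Mkmx_invFkmx (k : 'I_(nelt Me)) :
  Mmx S + Kmx S \in unitmx -> Mkmx S k \in unitmx ->
  Mkmx S k *m invmx (Fkmx S k) = (Mmx S + Kmx S) *m PJV S k.
Proof.
move=> MK_unit Mk_unit.
have PJV_unit : PJV S k \in unitmx.
  by move: Mk_unit; rewrite -Mmx_PJV unitmx_mul => /andP[].
have MIK : Mmx S *m (1%:M + invmx (Mmx S) *m Kmx S) = Mmx S + Kmx S.
  by rewrite mulmxDr mulmx1 mulKVmx.
have IK_unit : 1%:M + invmx (Mmx S) *m Kmx S \in unitmx.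
  by move: MK_unit; rewrite -MIK unitmx_mul => /andP[].
have Fk_unit : Fkmx S k \in unitmx.
  by rewrite /Fkmx /Fmx !unitmx_mul !unitmx_inv PJV_unit IK_unit.
have PJV_Fk : PJV S k *m Fkmx S k = Fmx S *m PJV S k.
  by rewrite /Fkmx -(mulmxA (invmx _)) mulKVmx.
apply: (can_inj (mulmxK Fk_unit)); rewrite mulmxKV // -(mulmxA (_ + _)) PJV_Fk.
by rewrite -MIK -(mulmxA (Mmx S)) mulKVmx // Mmx_PJV.
Qed.

End ReferenceOperators.

Theorem theorem4p2 (R : realType) (d Neq : nat)
    (E : refElement R d) (S : refDiscretization E) (Me : mesh E)
    (Law : conservationLaw R d Neq) (T : R) (T_gt0 : 0 < T)
    (Uplus : extData Neq S Me)
    (sbp : forall (m : 'I_d) (u v : 'cV[R]_d -> R), polyV S u -> polyV S v ->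
       ipW S u (pderiv m v) + ipW S (pderiv m u) v
       = \sum_(g < nfac E) rnormal g m 0 * ipWf S g u v)
    (rankV : \rank (Vmx S) = Np S)
    (W_spd : spd (Wmx S))
    (Wf_spd : forall g : 'I_(nfac E), spd (Wfmx S g))
    (Mk_unit : forall k : 'I_(nelt Me), Mkmx S k \in unitmx)
    (KD0 : forall m : 'I_d, Kmx S *m Dmx S m = 0)
    (MK_spd : spd (Mmx S + Kmx S))
    (u : coeffs Neq S Me) (u_adm : admissible Law T Uplus u) :
  FR_method Law T Uplus u <-> filteredDG_method Law T Uplus u.
Proof.
have M_unit : Mmx S \in unitmx by apply/spd_unitmx/spd_congr.
have MK_unit := spd_unitmx MK_spd.
suff residual k e t :
  (Mmx S + Kmx S) *m (PJV S k *m derive1 (u k e) t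
    + \sum_(m < d) Dmx S m *m Pmx S *m fvec Law u k m e t
    + \sum_(g < nfac E) Lmx S g *m
        (fstar Law Uplus u k g e t - \sum_(n < d) rnormal g n 0 *:
           (Vfmx S g *m Pmx S *m fvec Law u k n e t)))
  = Mkmx S k *m invmx (Fkmx S k) *m derive1 (u k e) t
    - \sum_(m < d) (Dmx S m)^T *m (Vmx S)^T *m Wmx S *m fvec Law u k m e t
    + \sum_(g < nfac E) (Vfmx S g)^T *m Wfmx S g *m fstar Law Uplus u k g e t.
  split=> solves k e t tT; first by rewrite -residual solves // mulmx0.
  by apply: (can_inj (mulKmx MK_unit)); rewrite residual solves // mulmx0.
rewrite !mulmxDr mulmxA -Mkmx_invFkmx // -!addrA; congr (_ + _).
have lift (g : 'I_(nfac E)) (x : 'cV[R]_(nfn S g)) :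
    (Mmx S + Kmx S) *m (Lmx S g *m x) = (Vfmx S g)^T *m Wfmx S g *m x.
  by rewrite /Lmx !mulmxA mulmxV // mul1mx.
rewrite [X in _ + X]mulmx_sumr; under [X in _ + X]eq_bigr do rewrite lift mulmxBr.
rewrite sumrB addrCA addrC; congr (_ + _).
(* The facet correction is regrouped by coordinate direction, to pair its m-th
   part with the m-th volume term: this is where summation by parts applies. *)
under [X in _ - X]eq_bigr do rewrite mulmx_sumr.
rewrite [X in _ - X]exchange_big /= mulmx_sumr -sumrB -sumrN.
apply: eq_bigr => m _.
have -> : (Mmx S + Kmx S) *m (Dmx S m *m Pmx S *m fvec Law u k m e t)
    = Mmx S *m Dmx S m *m (Pmx S *m fvec Law u k m e t).
  by rewrite !mulmxA mulmxDl KD0 addr0.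
have -> : \sum_(g < nfac E) (Vfmx S g)^T *m Wfmx S g *m
      (rnormal g m 0 *: (Vfmx S g *m Pmx S *m fvec Law u k m e t))
    = (Mmx S *m Dmx S m + (Dmx S m)^T *m Mmx S)
      *m (Pmx S *m fvec Law u k m e t).
  rewrite (sbp_matrix (sbp m)) mulmx_suml; apply: eq_bigr => g _.
  by rewrite -scalemxAr -scalemxAl !mulmxA.
rewrite -mulmxBl opprD addrA subrr add0r mulNmx.
by rewrite -(mulmxA _ (Mmx S)) (mulmxA (Mmx S)) Mmx_Pmx // !mulmxA.
Qed.
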